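(* Let $q$ be a power of $2$ and let $m \ge 2$ be an integer with $\gcd(q-1, m(m-1)) = 1$. Then every $d \in \mathbb{F}_q$ is the discriminant of the same number of monic polynomials of degree $m$ in $\mathbb{F}_q[x]$ (namely $q^{m-1}$ of them), and every $d \in \mathbb{F}_q^\times$ is the discriminant of the same number of monic irreducible polynomials of degree $m$ in $\mathbb{F}_q[x]$.
   Context: For a nonconstant polynomial $f$ of degree $m \ge 2$ over a field $K$ with leading coefficient $a_m$, factored as $f = a_m\prod_{i=1}^m (x-\alpha_i)$ in a splitting field, $\operatorname{disc}(f) = a_m^{2m-2}\prod_{i<j}(\alpha_i-\alpha_j)^2$; for linear $f$, $\operatorname{disc}(f) = 1$. $\mathbb{F}_q$ denotes the finite field with $q$ elements. *)

(* Defs.v *)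
From HB Require Import structures.
From mathcomp Require Import all_boot all_order all_algebra all_field.
From mathcomp Require Import boolp.
Set Implicit Arguments. Unset Strict Implicit. Unset Printing Implicit Defensive.
Import GRing.Theory.
Local Open Scope ring_scope.

Definition is_disc (F : fieldType) (f : {poly F}) (d : F) : Prop :=
  exists (L : fieldExtType F) (rs : seq L),
    [/\ map_poly (in_alg L) f
          = (in_alg L (lead_coef f))%:P * \prod_(r <- rs) ('X - r%:P),
        size rs = (size f).-1 &
        in_alg L d = in_alg L (lead_coef f) ^+ (2 * (size f).-1 - 2)
          * \prod_(i < size rs) \prod_(j < size rs | (i < j)%N)
              (rs`_i - rs`_j) ^+ 2].

(* The discriminant of f : {poly F} over a finite field F (the value is
   unique, the splitting-field definition being independent of choices);
   disc f = 1 for linear f. Constant polynomials get the junk value 0. *)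
Definition disc (F : finFieldType) (f : {poly F}) : F :=
  if size f == 2%N then 1
  else if (2 < size f)%N then
    odflt 0 [pick d : F | `[< is_disc f d >]]
  else 0.

Definition monic_of (F : finFieldType) (m : nat) (c : {ffun 'I_m -> F})
  : {poly F} := 'X^m + \sum_(i < m) c i *: 'X^i.

(* Main.v *)
(** Replacing f by a^m f(x/a) multiplies the discriminant by a^(m(m-1)), and
    preserves irreducibility.  Since m(m-1) is prime to q-1, a |-> a^(m(m-1)) is
    onto the nonzero elements, so all nonzero d are taken equally often.
    It remains to count the monic f with zero discriminant, i.e. the
    nonseparable ones.  Each monic f is uniquely g^2 h with g monic and h monic
    separable, and f is nonseparable iff g is nonconstant; writing
    g = g1 x + c, the map f |-> (c, g1^2 h) is a bijection onto pairs of a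
    constant and a monic polynomial of degree m-2, so there are q^(m-1) of them.

    In characteristic 2 the discriminant of a monic f is the product of f' over
    the roots of f.  This does not depend on the splitting field and lies in
    F_q, being either 0 or the norm of f' from F_q[x]/(f). *)
Require Import Defs.
From HB Require Import structures.
From mathcomp Require Import all_boot all_order all_algebra all_field.
From mathcomp Require Import boolp.
Import GRing.Theory.
Local Open Scope ring_scope.

(** * Monic polynomials in characteristic 2 as a square times a separable polynomial *)

Section SquarePart.
Variable F : finFieldType.
Hypothesis pcharF2 : 2%N \in [pchar F].
Implicit Types f g h u v p : {poly F}.

Lemma sqrt_exists (x : F) : exists y : F, y ^+ 2 = x.
Proof.
have inj2 : injective (fun y : F => y ^+ 2) by exact: (fmorph_inj (pFrobenius_aut pcharF2)).
by have [s _ sK] := injF_bij inj2; exists (s x); rewrite sK.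
Qed.

(** A zero derivative leaves only even exponents in characteristic 2. Frobenius is bijective on a
    finite field, so the coefficients have square roots, and additivity of squaring assembles them
    into a square root of [u]. *)
Lemma deriv0_square u : u^`() = 0 -> exists v, u = v ^+ 2.
Proof.
move=> du0; have [s sK] := choice sqrt_exists.
have pcharP : 2%N \in [pchar {poly F}] by rewrite pchar_poly.
have odd0 : odd_poly u = 0.
  apply/polyP => i; rewrite coef_odd_poly coef0.
  have := congr1 (fun p : {poly F} => p`_i.*2) du0.
  rewrite coef_deriv coef0 -mulr_natr -addn1 natrD -mul2n natrM.
  by rewrite (pcharf0 pcharF2) mul0r add0r mulr1.
exists (\sum_(i < size (even_poly u)) s (even_poly u)`_i *: 'X^i).
rewrite -[LHS]poly_even_odd odd0 comp_poly0 mul0r addr0 comp_polyE.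
rewrite -[RHS](pFrobenius_autE pcharP) rmorph_sum; apply: eq_bigr => i _.
by rewrite /= pFrobenius_autE exprZn sK -!exprM mulnC.
Qed.

(** Separability fails in one of two ways: two factors whose product divides [p] share a divisor,
    whose square then divides [p]; or a nonconstant divisor has zero derivative and is itself a
    square. *)
Lemma nonseparable_square p : p != 0 -> ~~ separable_poly p ->
  exists2 u : {poly F}, size u != 1%N & u ^+ 2 %| p.
Proof.
move=> p0 /negP nsep; apply: contrapT => nosq; apply: nsep.
apply/separable_polyP; split=> [u v uvp | u up u1].
  rewrite /coprimep; apply/negP => /negP gcd1; apply: nosq; exists (gcdp u v) => //.
  by apply: dvdp_trans uvp; rewrite expr2 dvdp_mul ?dvdp_gcdl ?dvdp_gcdr.
apply/eqP => /deriv0_square[v uE]; apply: nosq; exists v; last by rewrite -uE.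
apply: contraTneq u1 => /eqP/size_poly1P[c _ vE].
by rewrite uE vE -polyC_exp -leqNgt size_polyC_leq1.
Qed.

Lemma square_part_exists f : f \is monic ->
  exists gh : {poly F} * {poly F},
    [/\ gh.1 \is monic, gh.2 \is monic, separable_poly gh.2 & f = gh.1 ^+ 2 * gh.2].
Proof.
have [n] := ubnP (size f); elim: n f => // n IHn f ltfn monf.
have [sepf|nsepf] := boolP (separable_poly f).
  by exists (1, f); rewrite expr1n mul1r; split=> //; exact: monic1.
have f0 := monic_neq0 monf.
have [u u1 /dvdpP[h0 fE]] := nonseparable_square _ f0 nsepf.
have u0 : u != 0 by apply: contra_neq f0 => u0; rewrite fE u0 expr0n mulr0.
(* Both factors are normalized to be monic: the square of the leading coefficient of [u] moves into
   the cofactor. *)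
pose v := (lead_coef u)^-1 *: u.
have lu0 : lead_coef u != 0 by rewrite lead_coef_eq0.
have monv : v \is monic by rewrite monicE lead_coefZ mulVf.
have v1 : (1 < size v)%N.
  rewrite size_scale ?invr_eq0 // ltn_neqAle eq_sym u1 lt0n.
  by rewrite size_poly_eq0.
pose h := lead_coef u ^+ 2 *: h0.
have {}fE : f = v ^+ 2 * h.
  by rewrite fE mulrC exprZn -scalerAl -scalerAr scalerA -exprMn mulVf // expr1n scale1r.
have monh : h \is monic by rewrite fE monicMl ?monic_exp in monf.
have lth : (size h < n)%N.
  apply: leq_trans (ltfn : (size f <= n)%N).
  rewrite fE expr2 -mulrA !size_monicM ?monic_neq0 ?monicMl //.
  have := size_poly_gt0 h; rewrite (monic_neq0 monh).
  move: (size v) (size h) v1 => [|[|a]] // [|b] // _ _.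
  by rewrite !addSn /= ?addnS ?addSn /= !ltnS addnA leqW ?leq_addl.
have [[g k] /= [mong monk sepk hE]] := IHn h lth monh.
exists (v * g, k); split=> //=; first by rewrite monicMl.
by rewrite fE hE exprMn mulrA.
Qed.

(** Dividing [g] and [g1] by their gcd leaves coprime [a] and [b] with [a^2 h = b^2 h1]. Hence [a^2]
    divides the separable [h1], so [a] is constant. Applied in both directions, this gives
    uniqueness of the square part. *)
Lemma square_part_dvd g h g1 h1 : g != 0 -> separable_poly h1 ->
  g ^+ 2 * h = g1 ^+ 2 * h1 -> g %| g1.
Proof.
move=> g0 seph1 E; have d0 : gcdp g g1 != 0 by rewrite gcdp_eq0 negb_and g0.
have [aE bE] := (divpK (dvdp_gcdl g g1), divpK (dvdp_gcdr g g1)).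
have cop : coprimep (g %/ gcdp g g1) (g1 %/ gcdp g g1).
  by rewrite coprimep_div_gcd ?g0.
move: (g %/ _) (g1 %/ _) aE bE cop => a b aE bE cop.
have a2h1 : a ^+ 2 %| h1.
  rewrite -(@Gauss_dvdpr _ _ (b ^+ 2)); last by rewrite coprimep_expl ?coprimep_expr.
  rewrite -(dvdp_mul2r _ _ (expf_neq0 2 d0)) [X in _ %| X]mulrAC -!exprMn aE bE -E.
  by rewrite dvdp_mulr.
have a1 : size a == 1.
  apply: contraTT a2h1 => a1; by rewrite separable_nosquare.
have /size_poly1P[c c0 aC] := a1.
by rewrite -aE aC mul_polyC dvdpZl // dvdp_gcdr.
Qed.

Lemma square_part_unique g h g1 h1 :
    g \is monic -> g1 \is monic -> separable_poly h -> separable_poly h1 ->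
  g ^+ 2 * h = g1 ^+ 2 * h1 -> g = g1 /\ h = h1.
Proof.
move=> mg mg1 sh sh1 E.
have gg1 : g = g1.
  apply/eqP; rewrite -eqp_monic //; apply/andP; split.
    exact: square_part_dvd _ _ _ _ (monic_neq0 mg) sh1 E.
  exact: square_part_dvd _ _ _ _ (monic_neq0 mg1) sh (esym E).
split=> //; apply: (mulfI (expf_neq0 2 (monic_neq0 mg))).
by rewrite E gg1.
Qed.

End SquarePart.

(** * The discriminant in characteristic 2 as a product of derivative values and as a norm *)

Lemma deriv_prod_XsubC_horner (R : comNzRingType) (n : nat) (a : 'I_n -> R) (i : 'I_n) :
  (\prod_j ('X - (a j)%:P))^`().[a i] = \prod_(j | j != i) (a i - a j).
Proof.
rewrite (bigD1 i) //= derivM derivXsubC mul1r hornerD hornerM hornerXsubC subrr.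
rewrite mul0r addr0 horner_prod; apply: eq_bigr => j _.
by rewrite hornerXsubC.
Qed.

Lemma prod_diff_sq_pchar2 (R : comNzRingType) (rs : seq R) : 2%N \in [pchar R] ->
  \prod_(i < size rs) \prod_(j < size rs | (i < j)%N) (rs`_i - rs`_j) ^+ 2
  = \prod_(r <- rs) (\prod_(s <- rs) ('X - s%:P))^`().[r].
Proof.
move=> pcharR2.
have -> : \prod_(s <- rs) ('X - s%:P) = \prod_(j < size rs) ('X - (rs`_j)%:P).
  by rewrite (big_nth 0) big_mkord.
rewrite [RHS](big_nth 0) big_mkord.
pose D (i j : 'I_(size rs)) := rs`_i - rs`_j.
under [RHS]eq_bigr => i _ do
  rewrite (deriv_prod_XsubC_horner _ _ (fun i => rs`_i)) (bigID (fun j : 'I__ => (i < j)%N)) /=.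
rewrite big_split /=.
have -> : \prod_(i < size rs) \prod_(j < size rs | (j != i) && (i < j)%N) D i j
        = \prod_(i < size rs) \prod_(j < size rs | (i < j)%N) D i j.
  apply: eq_bigr => i _; apply: eq_bigl => j.
  by rewrite andb_idl // neq_ltn => ->; rewrite orbT.
(* The pairs with [j < i] become those with [i < j] once the two products are exchanged; the
   resulting signs are trivial in characteristic 2. *)
have -> : \prod_(i < size rs) \prod_(j < size rs | (j != i) && ~~ (i < j)%N) D i j
        = \prod_(i < size rs) \prod_(j < size rs | (i < j)%N) D i j.
  rewrite [RHS](exchange_big_dep predT) //=; apply: eq_bigr => i _.
  apply: eq_big => [j|j _]; first by rewrite -leqNgt ltn_neqAle.
  by rewrite /D -(oppr_pchar2 pcharR2 (rs`_i - _)) opprB.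
rewrite -big_split /=; apply: eq_bigr => i _.
by rewrite -big_split /=; apply: eq_bigr => j _; rewrite expr2.
Qed.

(** In the monomial basis, acting on row vectors, this is multiplication by [g] on F[x]/(f) when [f]
    has degree [m]; its determinant is then the norm of [g]. *)
Definition mulmod_mx (F : fieldType) (m : nat) (f g : {poly F}) : 'M[F]_m :=
  \matrix_(i, j) (('X^i * g) %% f)`_j.

(* The Vandermonde matrix of the roots conjugates multiplication by g in
   F[x]/(f) to the diagonal matrix of the values of g at the roots. *)
Lemma det_mulmod_mx (F L : fieldType) (iota : {rmorphism F -> L})
    (f g : {poly F}) (rs : seq L) :
    map_poly iota f = \prod_(r <- rs) ('X - r%:P) -> uniq rs ->
  iota (\det (mulmod_mx F (size rs) f g)) = \prod_(r <- rs) (map_poly iota g).[r].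
Proof.
move=> fE uniq_rs; set m := size rs.
pose a : 'rV[L]_m := \row_j rs`_j; pose V := Vandermonde m a.
have sf : size f = m.+1 by rewrite -(size_map_poly iota) fE size_prod_XsubC.
have f0 : f != 0 by rewrite -size_poly_eq0 sf.
have root_f (j : 'I_m) : (map_poly iota f).[rs`_j] = 0.
  by apply/rootP; rewrite fE root_prod_XsubC mem_nth.
have conjV : map_mx iota (mulmod_mx F m f g) *m V
    = V *m diag_mx (\row_j (map_poly iota g).[rs`_j]).
  apply/matrixP => i j; rewrite mul_mx_diag !mxE.
  have sz : (size (map_poly iota (('X^i * g) %% f)) <= m)%N.
    by rewrite size_map_poly -ltnS -sf ltn_modp.
  (* Both entries are the value of ['X^i * g] at the [j]-th root, which reduction modulo [f] does
     not change. *)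
  transitivity (map_poly iota (('X^i * g) %% f)).[rs`_j].
    rewrite (horner_coef_wide _ sz); apply: eq_bigr => l _.
    by rewrite !mxE coef_map.
  have := congr1 (fun p => (map_poly iota p).[rs`_j]) (divp_eq ('X^i * g) f).
  rewrite /= rmorphD !rmorphM /= hornerD !hornerM root_f mulr0 add0r => <-.
  by rewrite map_polyXn hornerXn.
have detV : \det V != 0.
  rewrite det_Vandermonde; apply/prodf_neq0 => i _; apply/prodf_neq0 => j ij.
  by rewrite !mxE subr_eq0 nth_uniq // gtn_eqF.
apply: (mulIf detV); rewrite -det_map_mx -det_mulmx conjV det_mulmx mulrC.
congr (_ * _); rewrite det_diag (big_nth 0) big_mkord.
by apply: eq_bigr => i _; rewrite mxE.
Qed.

(** * Discriminants of monic polynomials: uniqueness, vanishing, and scaling of the roots *)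

Section Discriminant.
Variable F : finFieldType.
Hypothesis pcharF2 : 2%N \in [pchar F].
Implicit Types (f : {poly F}) (L : fieldExtType F).

Lemma is_disc_monicP f d : f \is monic ->
  is_disc f d <-> exists (L : fieldExtType F) (rs : seq L),
    map_poly (in_alg L) f = \prod_(r <- rs) ('X - r%:P) /\
    in_alg L d = \prod_(r <- rs) (map_poly (in_alg L) f^`()).[r].
Proof.
move=> /monicP lf1; split=> [[L [rs []]]|[L [rs [fE dE]]]].
  rewrite lf1 rmorph1 mul1r expr1n mul1r => fE _ dE; exists L, rs; split=> //.
  by rewrite dE prod_diff_sq_pchar2 ?(rmorph_pchar (in_alg L)) // -deriv_map fE.
exists L, rs; rewrite lf1 rmorph1 mul1r expr1n mul1r; split=> //.
  by rewrite -(size_map_poly (in_alg L)) fE size_prod_XsubC.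
by rewrite dE prod_diff_sq_pchar2 ?(rmorph_pchar (in_alg L)) // -deriv_map fE.
Qed.

(** A vanishing factor means a common root of [f] and its derivative, that is, failure of
    coprimality. *)
Lemma prod_deriv_roots_eq0 L f (rs : seq L) :
    map_poly (in_alg L) f = \prod_(r <- rs) ('X - r%:P) ->
  (\prod_(r <- rs) (map_poly (in_alg L) f^`()).[r] == 0) = ~~ separable_poly f.
Proof.
move=> fE; rewrite -(separable_map (in_alg L)) separable_poly.unlock fE.
(* The derivative is generalized to an arbitrary [g], since it would otherwise vary with [rs] during
   the induction. *)
rewrite -deriv_map fE; set g := _^`().
elim: rs {f fE} g => [|r rs IHrs] g; first by rewrite !big_nil oner_eq0 coprime1p.
rewrite !big_cons mulf_eq0 IHrs coprimepMl negb_and; congr (_ || _).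
by rewrite coprimep_sym coprimep_XsubC negbK.
Qed.

Lemma splitting_roots f : f \is monic ->
  exists (L : fieldExtType F) (rs : seq L),
    map_poly (in_alg L) f = \prod_(r <- rs) ('X - r%:P).
Proof.
move=> monf; have [L [rs fE _]] := FinSplittingFieldFor (monic_neq0 monf).
exists L, rs; apply/eqP; rewrite -eqp_monic ?map_monic //.
exact: monic_prod_XsubC.
Qed.

(** The right-hand side mentions no splitting field, so it gives both existence and uniqueness of
    the discriminant. The case split reflects that the Vandermonde argument requires distinct
    roots. *)
Lemma is_disc_monicE f d m : f \is monic -> size f = m.+1 ->
  is_disc f d <->
  d = if separable_poly f then \det (mulmod_mx F m f f^`()) else 0.
Proof.
move=> monf sf.
have valE L (rs : seq L) : map_poly (in_alg L) f = \prod_(r <- rs) ('X - r%:P) ->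
  in_alg L (if separable_poly f then \det (mulmod_mx F m f f^`()) else 0)
  = \prod_(r <- rs) (map_poly (in_alg L) f^`()).[r].
  move=> fE; case: ifP => [sepf|/negbT nsepf].
    have <- : size rs = m.
      by apply: succn_inj; rewrite -sf -(size_map_poly (in_alg L)) fE size_prod_XsubC.
    apply: det_mulmod_mx => //.
    by rewrite -separable_prod_XsubC -fE separable_map.
  by rewrite rmorph0; apply/esym/eqP; rewrite prod_deriv_roots_eq0.
rewrite is_disc_monicP //; split=> [[L [rs [fE dE]]]|->].
  by apply: (fmorph_inj (in_alg L)); apply: etrans dE (esym (valE _ _ fE)).
have [L [rs fE]] := splitting_roots f monf.
by exists L, rs; split=> //; exact: valE.
Qed.

(** Exactly one value satisfies [is_disc], so the choice in [disc] finds it and never falls back on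
    the default 0. *)
Lemma discP f d : f \is monic -> (2 < size f)%N -> disc f = d <-> is_disc f d.
Proof.
move=> monf sf2; rewrite /disc gtn_eqF // sf2.
have [m sf] : exists m, size f = m.+1 by exists (size f).-1; rewrite prednK // (ltnW (ltnW sf2)).
have discE d' := is_disc_monicE f d' m monf sf.
case: pickP => [d1 /asboolP/discE d1E|nodisc] /=.
  by rewrite discE d1E; split=> ->.
have := nodisc (if separable_poly f then \det (mulmod_mx F m f f^`()) else 0).
by move/asboolP; case; apply/discE.
Qed.

Lemma disc_eq0 f : f \is monic -> (2 < size f)%N ->
  (disc f == 0) = ~~ separable_poly f.
Proof.
move=> monf sf2; have /(discP f _ monf sf2) := erefl (disc f).
move=> /(is_disc_monicP f _ monf)[L [rs [fE dE]]].
by rewrite -(prod_deriv_roots_eq0 _ _ _ fE) -dE fmorph_eq0.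
Qed.

Lemma scale_prod_XsubC (K : fieldType) (a : K) (rs : seq K) : a != 0 ->
  a ^+ size rs *: ((\prod_(r <- rs) ('X - r%:P)) \Po (a^-1 *: 'X))
  = \prod_(r <- rs) ('X - (a * r)%:P).
Proof.
move=> a0; elim: rs => [|r rs IHrs]; first by rewrite !big_nil comp_polyC scale1r.
rewrite !big_cons comp_polyM exprS -scalerA scalerAr IHrs scalerAl; congr (_ * _).
by rewrite comp_polyB comp_polyX comp_polyC scalerBr scalerA divff // scale1r polyCM mul_polyC.
Qed.

(* For a != 0, the roots of this polynomial are a times those of f. *)
Definition scale_roots (a : F) f : {poly F} :=
  a ^+ (size f).-1 *: (f \Po (a^-1 *: 'X)).

Lemma size_scale_roots (a : F) f : a != 0 -> size (scale_roots a f) = size f.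
Proof.
move=> a0; rewrite size_scale ?expf_neq0 // size_comp_poly2 //.
by rewrite size_scale ?invr_eq0 // size_polyX.
Qed.

Lemma monic_scale_roots (a : F) f : a != 0 -> f \is monic ->
  scale_roots a f \is monic.
Proof.
move=> a0 /monicP lf; have sX : size (a^-1 *: 'X : {poly F}) = 2%N.
  by rewrite size_scale ?invr_eq0 // size_polyX.
rewrite monicE lead_coefZ lead_coef_comp ?sX // lf mul1r lead_coefZ lead_coefX.
by rewrite mulr1 -exprMn divff // expr1n.
Qed.

Lemma scale_rootsK (a : F) : a != 0 -> cancel (scale_roots a) (scale_roots a^-1).
Proof.
move=> a0 f; rewrite /scale_roots size_scale_roots // comp_polyZ -comp_polyA.
rewrite comp_polyZ comp_polyX scalerA invrK scalerA mulVf // scale1r comp_polyXr.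
by rewrite -exprMn mulVf // expr1n scale1r.
Qed.

Lemma deriv_scale_roots (a : F) f : a != 0 -> (1 < size f)%N ->
  (scale_roots a f)^`() = a ^+ (size f).-2 *: (f^`() \Po (a^-1 *: 'X)).
Proof.
move=> a0; case sf: (size f) => [|[|s]] // _.
rewrite /scale_roots sf derivZ deriv_comp derivZ derivX alg_polyC mulrC mul_polyC.
by rewrite scalerA exprSr mulfK.
Qed.

(** With m the degree of [f], the derivative of the scaled polynomial at [a * r] is a^(m-1) times
    the derivative of [f] at [r]; the product runs over m roots. *)
Lemma disc_scale_roots (a : F) f : a != 0 -> f \is monic -> (2 < size f)%N ->
  disc (scale_roots a f) = a ^+ ((size f).-1 * (size f).-2) * disc f.
Proof.
move=> a0 monf sf2.
apply/discP; rewrite ?monic_scale_roots ?size_scale_roots //.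
apply/is_disc_monicP; first exact: monic_scale_roots.
have /(discP f _ monf sf2)/(is_disc_monicP f _ monf)[L [rs [fE dE]]] := erefl (disc f).
have srs : (size f).-1 = size rs.
  by rewrite -(size_map_poly (in_alg L)) fE size_prod_XsubC.
exists L, [seq in_alg L a * r | r <- rs]; split.
  rewrite big_map map_polyZ map_comp_poly map_polyZ map_polyX fE rmorphXn fmorphV srs.
  by rewrite scale_prod_XsubC // fmorph_eq0.
rewrite big_map rmorphM rmorphXn [X in _ * X]dE.
have derE r : (map_poly (in_alg L) (scale_roots a f)^`()).[in_alg L a * r]
    = in_alg L a ^+ (size f).-2 * (map_poly (in_alg L) f^`()).[r].
  have aL0 : in_alg L a != 0 by rewrite fmorph_eq0.
  rewrite deriv_scale_roots ?(ltnW sf2) // map_polyZ map_comp_poly map_polyZ map_polyX.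
  by rewrite hornerZ horner_comp hornerZ hornerX rmorphXn fmorphV mulKf.
under [RHS]eq_bigr => r _ do rewrite derE.
rewrite big_split /= big_const_seq count_predT -srs iter_mulr_1 -exprM.
by rewrite mulnC.
Qed.

End Discriminant.

(** * Counting monic polynomials through their lower coefficients *)

Section Counting.
Variable F : finFieldType.
Implicit Types (f g h p q : {poly F}).

Lemma dvdp_scale_roots (a : F) p q : a != 0 ->
  p %| q -> scale_roots F a p %| scale_roots F a q.
Proof.
by move=> a0 pq; rewrite dvdpZl ?dvdpZr ?expf_neq0 // dvdp_comp_poly.
Qed.

(** Scaling preserves divisibility and is undone by scaling with [a^-1], so a divisor of the scaled
    polynomial pulls back to a divisor of [p]. *)
Lemma irreducible_scale_roots (a : F) p : a != 0 ->
  irreducible_poly p -> irreducible_poly (scale_roots F a p).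
Proof.
move=> a0 [p1 irrp]; split=> [|q q1 qp]; first by rewrite size_scale_roots.
have ai0 : a^-1 != 0 by rewrite invr_eq0.
have qK : scale_roots F a (scale_roots F a^-1 q) = q.
  by rewrite -{1}[a]invrK scale_rootsK.
have /irrp : size (scale_roots F a^-1 q) != 1%N by rewrite size_scale_roots.
have := dvdp_scale_roots _ _ _ ai0 qp; rewrite scale_rootsK // => qp' /(_ qp').
by rewrite -{2}qK => /andP[? ?]; apply/andP; split; apply: dvdp_scale_roots.
Qed.

Definition low_coefs (m : nat) f : {ffun 'I_m -> F} := [ffun i : 'I_m => f`_i].

Lemma coef_monic_of m (c : {ffun 'I_m -> F}) (i : 'I_m) : (monic_of c)`_i = c i.
Proof.
rewrite /monic_of coefD coefXn ltn_eqF // add0r coef_sum (bigD1 i) //= coefZ coefXn.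
rewrite eqxx mulr1 big1 ?addr0 // => j ji.
by rewrite coefZ coefXn eq_sym [_ == _ :> nat](negPf ji) mulr0.
Qed.

Lemma size_sum_coefs m (c : {ffun 'I_m -> F}) :
  (size (\sum_(i < m) c i *: 'X^i : {poly F})%R < size ('X^m : {poly F})%R)%N.
Proof.
rewrite size_polyXn ltnS (leq_trans (size_sum _ _ _)) //; apply/bigmax_leqP => i _.
by rewrite (leq_trans (size_scale_leq _ _)) // size_polyXn.
Qed.

Lemma size_monic_of m (c : {ffun 'I_m -> F}) : size (monic_of c) = m.+1.
Proof. by rewrite size_polyDl ?size_sum_coefs ?size_polyXn. Qed.

Lemma monic_of_monic m (c : {ffun 'I_m -> F}) : monic_of c \is monic.
Proof. by rewrite monicE lead_coefDl ?size_sum_coefs // lead_coefXn. Qed.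

Lemma monic_ofK m : cancel (@monic_of F m) (low_coefs m).
Proof. by move=> c; apply/ffunP => i; rewrite ffunE coef_monic_of. Qed.

Lemma low_coefsK m f : f \is monic -> size f = m.+1 -> monic_of (low_coefs m f) = f.
Proof.
move=> /monicP lf sf; apply/polyP => i; have [im|mi] := ltnP i m.
  by rewrite (coef_monic_of m _ (Ordinal im)) ffunE.
have [<-|im] := eqVneq m i.
  have := monicP (monic_of_monic m (low_coefs m f)).
  by rewrite -[in RHS]lf !lead_coefE size_monic_of sf.
have mi' : (m < i)%N by rewrite ltn_neqAle im.
by rewrite !nth_default ?size_monic_of ?sf.
Qed.

Lemma monic_mulX_addC g (c : F) : g \is monic ->
  (g * 'X + c%:P \is monic) /\ size (g * 'X + c%:P) = (size g).+1.
Proof.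
move=> mg; have g0 := monic_neq0 mg.
have sz : (size c%:P < size (g * 'X)%R)%N.
  by rewrite size_mulX // ltnS (leq_trans (size_polyC_leq1 c)) // size_poly_gt0.
by rewrite monicE lead_coefDl // lead_coefMX size_polyDl // size_mulX.
Qed.

Lemma monic_nonconstant g : g \is monic -> size g != 1%N ->
  exists g1 c, g1 \is monic /\ g = g1 * 'X + c%:P.
Proof.
move=> + g1; elim/poly_ind: g g1 => [_ /monic_neq0 /eqP//|g c _ g1 mg].
exists g, c; split=> //.
have g0 : g != 0.
  apply: contraNneq g1 => g0; have := monic_neq0 mg.
  by rewrite g0 mul0r add0r => c0; rewrite size_polyC -polyC_eq0 c0.
move: mg; rewrite !monicE lead_coefDl ?lead_coefMX //.
by rewrite size_mulX // ltnS (leq_trans (size_polyC_leq1 c)) // size_poly_gt0.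
Qed.

Lemma size_monic_sqM g h g1 : g \is monic -> h \is monic -> g1 \is monic ->
  size g1 = (size g).+1 -> size (g1 ^+ 2 * h) = (size (g ^+ 2 * h)).+2.
Proof.
move=> mg mh mg1 sg; rewrite !expr2 -!mulrA !size_monicM ?monic_neq0 ?monicMl // sg.
have := size_poly_gt0 g; have := size_poly_gt0 h; rewrite !monic_neq0 //.
by move: (size g) (size h) => [|a] // [|b] // _ _; rewrite !(addnS, addSn).
Qed.

Lemma card_nonseparable m : 2%N \in [pchar F] ->
  #|[set c : {ffun 'I_m.+2 -> F} | ~~ separable_poly (monic_of c)]| = (#|F| ^ m.+1)%N.
Proof.
move=> pcharF2.
(* Monicity is a premise inside the chosen relation, so that [choice] applies to all polynomials;
   non-monic ones get the dummy pair [(0, 0)]. *)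
have [|dec decP] := @choice {poly F} ({poly F} * {poly F}) (fun f gh => f \is monic ->
    [/\ gh.1 \is monic, gh.2 \is monic, separable_poly gh.2 & f = gh.1 ^+ 2 * gh.2]).
  move=> f; have [mf|nmf] := boolP (f \is monic); last by exists (0, 0).
  by have [gh ?] := square_part_exists F pcharF2 f mf; exists gh.
(* This is the inverse of the bijection: the square part g of a monic polynomial of degree [m] is
   replaced by g x + c, raising the degree by 2. *)
pose ext (ce : F * {ffun 'I_m -> F}) : {poly F} :=
  let gh := dec (monic_of ce.2) in (gh.1 * 'X + ce.1%:P) ^+ 2 * gh.2.
have extP ce : ext ce \is monic /\ size (ext ce) = m.+3.
  have [mg mh _ fE] := decP _ (monic_of_monic m ce.2).
  have [mG sG] := monic_mulX_addC _ ce.1 mg.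
  split; first by rewrite monicMl ?monic_exp.
  by rewrite (size_monic_sqM _ _ _ mg mh mG sG) -fE size_monic_of.
pose phi ce := low_coefs m.+2 (ext ce).
have phiK ce : monic_of (phi ce) = ext ce by case: (extP ce); apply: low_coefsK.
have phi_inj : injective phi.
  move=> [c e] [c' e'] /(congr1 (fun x => monic_of x)); rewrite !phiK /ext /=.
  have [mg mh sh fE] := decP _ (monic_of_monic m e).
  have [mg' mh' sh' fE'] := decP _ (monic_of_monic m e').
  have [[mG _] [mG' _]] := (monic_mulX_addC _ c mg, monic_mulX_addC _ c' mg').
  case/(square_part_unique _ _ _ _ _ mG mG' sh sh') => GE hE.
  (* Evaluation at 0 recovers the constant; cancelling it and then ['X] recovers the old square
     part. *)
  have cE : c = c'.
    by have := congr1 (horner^~ 0) GE; rewrite !hornerMXaddC !mulr0 !add0r.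
  rewrite cE in GE *; move/addIr: GE => /(mulIf (negbT (polyX_eq0 F))) gE.
  by congr (_, _); apply: (can_inj (monic_ofK m)); rewrite fE fE' gE hE.
transitivity #|phi @: [set: F * {ffun 'I_m -> F}]|.
  apply: eq_card => c; rewrite inE; apply/idP/imsetP => [nsep|[ce _ ->]].
    have [mg mh sh fE] := decP _ (monic_of_monic _ c).
    move: (dec _) mg mh sh fE => [g h] /= mg mh sh fE.
    have g1 : size g != 1%N.
      (* A constant monic [g] would be 1, making the polynomial equal to the separable [h]. *)
      apply: contraNN nsep => /eqP g1; move: mg sh; rewrite fE monicE.
      have /eqP/size_poly1P[x x0 ->] := g1.
      by rewrite lead_coefC => /eqP ->; rewrite expr1n mul1r.
    have [g' [x [mg' gE]]] := monic_nonconstant _ mg g1.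
    have [mG sG] := monic_mulX_addC _ x mg'.
    pose f' := g' ^+ 2 * h.
    have mf' : f' \is monic by rewrite monicMl ?monic_exp.
    have sf' : size f' = m.+1.
      apply: succn_inj; apply: succn_inj; rewrite -(size_monic_of _ c) fE gE.
      by rewrite (size_monic_sqM _ _ _ mg' mh mG sG).
    exists (x, low_coefs m f'); first by rewrite in_setT.
    apply: (can_inj (monic_ofK m.+2)).
    rewrite phiK /ext /= low_coefsK //.
    have [mg2 mh2 sh2 f'E] := decP _ mf'.
    (* By uniqueness, [dec] returns exactly [g'] and [h] on [f'], so [ext] rebuilds the original
       polynomial. *)
    have [<- <-] := square_part_unique _ _ _ _ _ mg' mg2 sh sh2 f'E.
    by rewrite fE gE.
  rewrite phiK; have [mg mh _ _] := decP _ (monic_of_monic m ce.2).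
  have [mG sG] := monic_mulX_addC _ ce.1 mg.
  apply/negP => sep.
  have := @separable_nosquare _ (ext ce) ((dec (monic_of ce.2)).1 * 'X + ce.1%:P) 2 sep isT.
  by rewrite dvdp_mulr // sG eqSS size_poly_eq0 monic_neq0 // => /(_ isT).
by rewrite card_imset // cardsT card_prod card_ffun card_ord expnS.
Qed.

(** Scaling the roots by [a] injects one set into the other. The predicate [P] lets one argument
    serve both all monic polynomials and the irreducible ones. *)
Lemma card_disc_scale (P : pred {poly F}) (a : F) m (d : F) : 2%N \in [pchar F] ->
    (forall b f, b != 0 -> P f -> P (scale_roots F b f)) -> a != 0 -> (2 <= m)%N ->
  (#|[set c : {ffun 'I_m -> F} | P (monic_of c) & disc (monic_of c) == d]|
   <= #|[set c : {ffun 'I_m -> F} | P (monic_of c) &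
          disc (monic_of c) == (a ^+ (m * m.-1) * d)%R]|)%N.
Proof.
move=> pcharF2 PS a0 m2.
pose sigma b (c : {ffun 'I_m -> F}) := low_coefs m (scale_roots F b (monic_of c)).
have sigmaE b c : b != 0 -> monic_of (sigma b c) = scale_roots F b (monic_of c).
  move=> b0; apply: low_coefsK; first by rewrite monic_scale_roots ?monic_of_monic.
  by rewrite size_scale_roots ?size_monic_of.
have sigmaK : cancel (sigma a) (sigma a^-1).
  by move=> c; rewrite /sigma sigmaE // scale_rootsK // monic_ofK.
rewrite -(card_imset _ (can_inj sigmaK)); apply/subset_leq_card/subsetP => _ /imsetP[c + ->].
rewrite !inE sigmaE // disc_scale_roots ?monic_of_monic ?size_monic_of //.
by case/andP=> Pc /eqP ->; rewrite PS /=.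
Qed.

(** Bezout gives [u * n = v * (q-1) + 1] with q the order of the field, and d^(q-1) = 1, so [d ^+ u]
    is an [n]-th root of [d]. *)
Lemma root_of_unit (n : nat) (d : F) : coprime #|F|.-1 n -> (0 < n)%N -> d != 0 ->
  exists2 a : F, a != 0 & a ^+ n = d.
Proof.
move=> cop n0 d0; case: (egcdnP #|F|.-1 n0) => u v uE _.
exists (d ^+ u); first exact: expf_neq0.
have dq : d ^+ #|F|.-1 = 1.
  apply: (mulfI d0); rewrite -exprS prednK ?expf_card ?mulr1 //.
  exact: ltnW (finNzRing_gt1 F).
rewrite -exprM uE exprD mulnC exprM dq expr1n mul1r.
by move: cop; rewrite coprime_sym => /eqP ->.
Qed.

Lemma card_disc_unit (P : pred {poly F}) m (d : F) : 2%N \in [pchar F] ->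
    (forall b f, b != 0 -> P f -> P (scale_roots F b f)) ->
    (2 <= m)%N -> coprime #|F|.-1 (m * m.-1) -> d != 0 ->
  #|[set c : {ffun 'I_m -> F} | P (monic_of c) & disc (monic_of c) == d]|
  = #|[set c : {ffun 'I_m -> F} | P (monic_of c) & disc (monic_of c) == 1]|.
Proof.
move=> pcharF2 PS m2 cop d0.
have m0 : (0 < m * m.-1)%N by case: m m2 {cop} => [|[|m]].
have [a a0 aE] := root_of_unit _ _ cop m0 d0.
(* Scaling by [a^-1] takes discriminant [d] to 1, and scaling by [a] takes 1 to [d], which gives the
   two inequalities. *)
apply/eqP; rewrite eqn_leq; apply/andP; split.
  have ai0 : a^-1 != 0 by rewrite invr_eq0.
  by have := card_disc_scale P _ m d pcharF2 PS ai0 m2; rewrite exprVn aE mulVf.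
by have := card_disc_scale P _ m 1 pcharF2 PS a0 m2; rewrite aE mulr1.
Qed.

End Counting.

Theorem theorem1p2 (F : finFieldType) (k : nat) (hq : #|F| = (2 ^ k)%N)
  (m : nat) (hm : (2 <= m)%N) (hg : coprime #|F|.-1 (m * m.-1)) :
  (forall d : F,
     #|[set c : {ffun 'I_m -> F} | disc (monic_of c) == d]| = (#|F| ^ m.-1)%N)
  /\
  (exists N : nat, forall d : F, d != 0 ->
     #|[set c : {ffun 'I_m -> F} |
         `[< irreducible_poly (monic_of c) >] && (disc (monic_of c) == d)]| = N).
Proof.
have pcharF2 : 2%N \in [pchar F] by exact: card_finPcharP hq isT.
split; last first.
  exists #|[set c : {ffun 'I_m -> F} |
      `[< irreducible_poly (monic_of c) >] && (disc (monic_of c) == 1)]| => d d0.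
  apply: (card_disc_unit F (fun f => `[< irreducible_poly f >])) => // b f b0 /asboolP irrf.
  exact/asboolP/irreducible_scale_roots.
have card_unit d : d != 0 -> #|[set c : {ffun 'I_m -> F} | disc (monic_of c) == d]|
    = #|[set c : {ffun 'I_m -> F} | disc (monic_of c) == 1]|.
  by move=> d0; apply: (card_disc_unit F predT).
have card0 : #|[set c : {ffun 'I_m -> F} | disc (monic_of c) == 0]| = (#|F| ^ m.-1)%N.
  case: m hm {hg card_unit} => [|[|n]] // _; rewrite -card_nonseparable //.
  apply: eq_card => c; rewrite !inE disc_eq0 ?monic_of_monic //.
  by rewrite size_monic_of.
have card1 : #|[set c : {ffun 'I_m -> F} | disc (monic_of c) == 1]| = (#|F| ^ m.-1)%N.
  have q1 := finNzRing_gt1 F.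
  (* All q^m monic polynomials are sorted by discriminant. Removing the q^(m-1) with discriminant
     zero leaves (q-1) q^(m-1), shared equally among the q-1 nonzero values. *)
  have tot : (\sum_(d : F) #|[set c : {ffun 'I_m -> F} | disc (monic_of c) == d]|
      = #|F| ^ m)%N.
    rewrite -[in RHS](card_ord m) -card_ffun -[RHS]sum1_card.
    rewrite (partition_big (fun c : {ffun 'I_m -> F} => disc (monic_of c)) predT) //=.
    by apply: eq_bigr => d _; rewrite sum1dep_card.
  move: tot.
  rewrite (bigD1 0) //= card0 (eq_bigr _ card_unit) sum_nat_const.
  have -> : #|[pred d : F | d != 0]| = #|F|.-1 by rewrite cardC1.
  have -> : (#|F| ^ m = #|F| ^ m.-1 + #|F|.-1 * #|F| ^ m.-1)%N.
    by rewrite -mulSn prednK ?(ltnW q1) // -expnS prednK // (ltnW hm).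
  move=> /addnI/eqP.
  by rewrite eqn_pmul2l ?ltn_predRL // => /eqP.
by move=> d; have [->|/card_unit ->] := eqVneq d 0.
Qed.
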